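(* Let $d\ge 1$ and $A\in H_{2d}^+(\mathbb{C})$ satisfy Assumptions I and II, and let $W_{>1}\in M_d(\mathbb{C})$ be an invertible diagonalizable matrix. The following assertions are equivalent: (i) The matrix $B_L=A_{RR}+A_{RL}W_{>1}^{-1}$ is left Schur-invariant for $A$. (ii) The matrix $W_{>1}$ is diagonal in the basis $(u_w)_{w\in\mathcal{S}_{>1}}$ of $\mathbb{C}^d$, with $W_{>1}u_w=wu_w$ for all $w\in\mathcal{S}_{>1}$. (iii) For every $\boldsymbol{x}\in\mathbb{C}^d$, the sequence $(x_k)_{k\le 0}$ defined by $x_0=\boldsymbol{x}$ and $x_k=W_{>1}^{k}x_0$ for $k\le 0$ is a solution of the discrete Dirichlet-type problem $$A_{RL}x_{-k-1}+(A_{LL}+A_{RR})x_{-k}+A_{LR}x_{-k+1}=0\ \text{ for all } k>0,\qquad x_0=\boldsymbol{x},\qquad \lim_{k\to-\infty}x_k=0.$$ Moreover, when these assertions hold, for all $\alpha,\beta_L>0$ the function $\boldsymbol{e}'_{\beta_L,B_L}$ satisfies $\int_{\mathbb{C}^d}\boldsymbol{e}'_{\beta_L,B_L}(x)\,\boldsymbol{e}_{\alpha,A}(x,y)\,dx=\Lambda\,\boldsymbol{e}'_{\beta_L,B_L}(y)$ for all $y\in\mathbb{C}^d$, with eigenvalue $$\Lambda=\alpha(2\pi)^d(-1)^d\,\frac{\prod_{w\in\mathcal{S}_{<1}}w}{\det(A_{RL})}.$$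
   Context: $H_n^+(\mathbb{C})$ is the set of $n\times n$ complex Hermitian positive definite matrices. A matrix $A\in H_{2d}^+(\mathbb{C})$ is written in $d\times d$ blocks $A=\begin{pmatrix} A_{LL} & A_{LR} \\ A_{RL} & A_{RR} \end{pmatrix}$. Define $\Phi(z)=\Phi_A(z)=A_{LL}+A_{RR}+A_{LR}z+A_{RL}z^{-1}\in M_d(\mathbb{C})$ for $z\in\mathbb{C}^*$, $\mathcal{S}=\{z\in\mathbb{C}^*:\det\Phi(z)=0\}$, $\mathcal{S}_{<1}=\{w\in\mathcal{S}:|w|<1\}$, $\mathcal{S}_{>1}=\{w\in\mathcal{S}:|w|>1\}$. ($\Phi(z)$ is Hermitian positive definite for $|z|=1$, so $\mathcal{S}=\mathcal{S}_{<1}\sqcup\mathcal{S}_{>1}$.) Assumption I: $\mathrm{rank}(A_{LR})=d$. Assumption II: every $w\in\mathcal{S}$ is a simple root of the polynomial $z^d\det\Phi(z)$ and $\dim\ker\Phi(w)=1$. Under II, for each $w\in\mathcal{S}$ a vector $u_w\neq0$ spanning $\ker\Phi(w)$ is fixed. Under I and II, $(u_w)_{w\in\mathcal{S}_{<1}}$ and $(u_w)_{w\in\mathcal{S}_{>1}}$ are bases of $\mathbb{C}^d$. A matrix $B_L\in M_d(\mathbb{C})$ is left Schur-invariant for $A$ if $B_L\in H_d^+(\mathbb{C})$ and $B_L=A_{RR}-A_{RL}(B_L+A_{LL})^{-1}A_{LR}$. For $\alpha,\beta>0$, $B\in H_d^+(\mathbb{C})$ and $x,y\in\mathbb{C}^d$: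 $\boldsymbol{e}_{\alpha,A}(x,y)=\alpha\exp\left(-\tfrac12\begin{pmatrix} x \\ y \end{pmatrix}^*A\begin{pmatrix} x \\ y \end{pmatrix}\right)$ and $\boldsymbol{e}'_{\beta,B}(x)=\beta\exp(-\tfrac12x^*Bx)$; $dx$ is Lebesgue measure on $\mathbb{C}^d\cong\mathbb{R}^{2d}$. *)

(* Defs.v *)
From HB Require Import structures.
From mathcomp Require Import all_boot all_order all_algebra.
From mathcomp Require Import sesquilinear spectral complex.
From mathcomp Require Import all_classical all_reals all_analysis.
From mathcomp Require Import ring.

Set Implicit Arguments.
Unset Strict Implicit.
Unset Printing Implicit Defensive.

Import Order.TTheory GRing.Theory Num.Theory.
Import numFieldNormedType.Exports.

Local Open Scope classical_set_scope.
Local Open Scope ring_scope.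
Local Open Scope complex_scope.
Local Open Scope sesquilinear_scope.

(* Vectors of C^n are column vectors over R[i]; 0 < z in R[i] means that z is
   real and positive. *)

Definition posdefmx (R : realType) (n : nat) (M : 'M[R[i]]_n) : Prop :=
  M \is hermsymmx /\ forall x : 'cV[R[i]]_n, x != 0 -> 0 < (x ^t* *m M *m x) 0 0.

Section Symbol.
Variables (R : realType) (d : nat) (A : 'M[R[i]]_(d + d)).

Local Notation C := R[i].

Definition A_LL : 'M[C]_d := ulsubmx A.
Definition A_LR : 'M[C]_d := ursubmx A.
Definition A_RL : 'M[C]_d := dlsubmx A.
Definition A_RR : 'M[C]_d := drsubmx A.

Definition Phi (z : C) : 'M[C]_d :=
  A_LL + A_RR + z *: A_LR + z^-1 *: A_RL.

Definition spec : set C := [set z | z != 0 /\ \det (Phi z) = 0].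
Definition spec_lt1 : set C := [set w | spec w /\ `|w| < 1].
Definition spec_gt1 : set C := [set w | spec w /\ 1 < `|w|].

(* The polynomial z^d det Phi(z) = det (z Phi(z)); see detPhi_polyE. *)
Definition detPhi_poly : {poly C} :=
  \det ('X *: map_mx polyC (A_LL + A_RR) + 'X^2 *: map_mx polyC A_LR
        + map_mx polyC A_RL).

Lemma detPhi_polyE (z : C) : z != 0 ->
  detPhi_poly.[z] = z ^+ d * \det (Phi z).
Proof.
move=> z0; rewrite -detZ -horner_evalE -det_map_mx; congr (\det _).
apply/matrixP => i j; rewrite !mxE /= /horner_eval !hornerE.
by field.
Qed.

Definition assumptionI : Prop := \rank A_LR = d.

(* The columns v such that Phi(w) v = 0 are those of the column space of
   cokermx (Phi w). *)
Definition assumptionII : Prop := forall w, spec w ->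
  mup w detPhi_poly = 1%N /\ \rank (cokermx (Phi w)) = 1%N.

Definition spans_kernels (u : C -> 'cV[C]_d) : Prop :=
  forall w, spec w -> u w != 0 /\
    forall v : 'cV[C]_d, Phi w *m v = 0 <-> exists c, v = c *: u w.

Definition left_schur_invariant (B : 'M[C]_d) : Prop :=
  posdefmx B /\ B = A_RR - A_RL *m invmx (B + A_LL) *m A_LR.

End Symbol.

Definition basis_family (R : realType) (d : nat) (D : set R[i])
    (u : R[i] -> 'cV[R[i]]_d) : Prop :=
  exists s : seq R[i],
    [/\ uniq s, D = [set` s] & basis_of {:'cV[R[i]]_d} (map u s)].

Definition diagonal_in_basis (R : realType) (d : nat) (D : set R[i])
    (u : R[i] -> 'cV[R[i]]_d) (W : 'M[R[i]]_d) : Prop :=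
  basis_family D u /\ forall w, D w -> W *m u w = w *: u w.

(* Integer powers; 'M_d is a unit ring only when d is syntactically a
   successor, so that the operator ^ of ssrint is not available. *)
Definition mxpowz (R : realType) (d : nat) (W : 'M[R[i]]_d) (k : int) :
    'M[R[i]]_d :=
  match k with Posz n => W ^+ n | Negz n => invmx W ^+ n.+1 end.

(* The values x k for k > 0 are irrelevant. The limit is for the topology of
   C^d, C carrying the topology of its modulus. *)
Definition dirichlet_solution (R : realType) (d : nat) (A : 'M[R[i]]_(d + d))
    (x0 : 'cV[R[i]]_d) (x : int -> 'cV[R[i]]_d) : Prop :=
  [/\ forall k : int, 0 < k ->
        A_RL A *m x (- k - 1) + (A_LL A + A_RR A) *m x (- k)
        + A_LR A *m x (- k + 1) = 0,
      x 0 = x0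
    & (fun n : nat => x (- n%:Z) : 'cV[R[i]^o]_d) @ \oo -->
      (0 : 'cV[R[i]^o]_d)].

(* x^* M x is real for a Hermitian M, so nothing is lost in taking Re. *)
Definition quad_form (R : realType) (n : nat) (M : 'M[R[i]]_n)
    (x : 'cV[R[i]]_n) : R := complex.Re ((x ^t* *m M *m x) 0 0).

Definition e_edge (R : realType) (d : nat) (alpha : R) (A : 'M[R[i]]_(d + d))
    (x y : 'cV[R[i]]_d) : R :=
  alpha * expR (- (2^-1 * quad_form A (col_mx x y))).

Definition e_vertex (R : realType) (d : nat) (beta : R) (B : 'M[R[i]]_d)
    (x : 'cV[R[i]]_d) : R :=
  beta * expR (- (2^-1 * quad_form B x)).

(* The product of two sigma-finite measures; the wrapper around \x carries the
   sigma-finite structure. *)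
Section SigmaFiniteProduct.
Context d1 d2 (T1 : measurableType d1) (T2 : measurableType d2) (R : realType).
Variables (m1 : {sigma_finite_measure set T1 -> \bar R})
  (m2 : {sigma_finite_measure set T2 -> \bar R}).

Definition sfprod : set (T1 * T2) -> \bar R := (m1 \x m2)%E.

HB.instance Definition _ := Measure.on sfprod.

Lemma sfprod_sigma_finite : sigma_finite setT sfprod.
Proof.
have /sigma_finiteP[F [TF ndF Foo]] := sigma_finiteT m1.
have /sigma_finiteP[G [TG ndG Goo]] := sigma_finiteT m2.
exists (fun n => F n `*` G n).
  rewrite -setXTT TF TG predeqE => -[x y]; split.
    move=> [/= [n _ Fnx] [k _ Gky]]; exists (maxn n k) => //; split.
    - by move: x Fnx; exact/subsetPset/ndF/leq_maxl.
    - by move: y Gky; exact/subsetPset/ndG/leq_maxr.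
  by move=> [n _ []/= ? ?]; split; exists n.
move=> k; have [? ?] := Foo k; have [? ?] := Goo k.
split; first exact: measurableX.
by rewrite /sfprod product_measure1E// lte_mul_pinfty// ge0_fin_numE.
Qed.

HB.instance Definition _ := Measure_isSigmaFinite.Build _ _ _
  sfprod sfprod_sigma_finite.

End SigmaFiniteProduct.

(* The n-fold power, on n.-tuple T, of a sigma-finite measure mu on T: the
   image of the product of mu and mu^(n-1) under (t, s) |-> t :: s. *)
Section PowerMeasure.
Context dT (T : measurableType dT) (R : realType).
Variable mu : {sigma_finite_measure set T -> \bar R}.

Definition cons_pair n (p : T * n.-tuple T) : n.+1.-tuple T :=
  [the n.+1.-tuple T of p.1 :: p.2].

Lemma measurable_cons_pair n : measurable_fun setT (@cons_pair n).
Proof. exact: measurable_cons. Qed.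

HB.instance Definition _ n :=
  isMeasurableFun.Build _ _ _ _ (@cons_pair n) (@measurable_cons_pair n).

Section PowerStep.
Variables (n : nat) (nu : {sigma_finite_measure set (n.-tuple T) -> \bar R}).

Definition pow_measure_step : set (n.+1.-tuple T) -> \bar R :=
  pushforward (sfprod mu nu) (@cons_pair n).

Let step0 : pow_measure_step set0 = 0%E.
Proof. exact: measure0. Qed.

Let step_ge0 X : (0 <= pow_measure_step X)%E.
Proof. exact: measure_ge0. Qed.

Let step_sigma_additive : semi_sigma_additive pow_measure_step.
Proof.
by apply: measure_semi_sigma_additive; exact: measurable_cons_pair.
Qed.

HB.instance Definition _ := isMeasure.Build _ _ _
  pow_measure_step step0 step_ge0 step_sigma_additive.

Lemma pow_measure_step_sigma_finite : sigma_finite setT pow_measure_step.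
Proof.
have [F FT Foo] := sfprod_sigma_finite mu nu.
pose uncons (t : n.+1.-tuple T) : T * n.-tuple T := (thead t, [tuple of behead t]).
have muncons : measurable_fun setT uncons.
  by apply: measurable_fun_pair; [exact: measurable_tnth|exact: measurable_behead].
have consK : cancel (@cons_pair n) uncons.
  by move=> [t s]; congr pair; apply/val_inj.
exists (fun k => uncons @^-1` F k).
  apply/seteqP; split=> // t _.
  have : [set: T * n.-tuple T] (uncons t) by [].
  by rewrite FT => -[k _ Fk]; exists k.
move=> k; have [mFk Fkoo] := Foo k; split.
  by rewrite -[X in measurable X]setTI; exact: muncons.
suff -> : pow_measure_step (uncons @^-1` F k) = (sfprod mu nu) (F k) by [].
rewrite /pow_measure_step /pushforward; congr (sfprod mu nu _).
by apply/seteqP; split=> p; rewrite /preimage /= consK.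
Qed.

HB.instance Definition _ := Measure_isSigmaFinite.Build _ _ _
  pow_measure_step pow_measure_step_sigma_finite.

End PowerStep.

Fixpoint pow_measure (n : nat) : {sigma_finite_measure set (n.-tuple T) -> \bar R} :=
  match n with
  | 0 => \d_([tuple] : 0.-tuple T)
  | m.+1 => pow_measure_step (pow_measure m)
  end.

End PowerMeasure.

(* Lebesgue measure on C^d = (R * R)^d, a vector being given by the real and
   imaginary parts of its coordinates. *)
Definition lebesgue_Cn (R : realType) (d : nat) :=
  pow_measure (sfprod (@lebesgue_measure R) (@lebesgue_measure R)) d.

Lemma lebesgue_Cn_box (R : realType) (d : nat)
    (F : nat -> set (measurableTypeR R * measurableTypeR R)) :
  (forall i, measurable (F i)) ->
  lebesgue_Cn R d [set t | forall i : 'I_d, F i (tnth t i)] =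
    (\prod_(i<d) (lebesgue_measure \x lebesgue_measure) (F i))%E.
Proof.
elim: d F => [|d IH] F mF; rewrite /lebesgue_Cn /=.
  by rewrite big_ord0 diracE mem_set//= => -[].
rewrite /pow_measure_step /pushforward /sfprod.
have -> : (cons_pair (n:=d)) @^-1` [set t | forall i : 'I_d.+1, F i (tnth t i)] =
    F 0%N `*` [set t | forall i : 'I_d, F i.+1 (tnth t i)].
  apply/seteqP; split => -[a s] /=.
    move=> H; split; first by have := H ord0.
    move=> i; have := H (lift ord0 i); rewrite /cons_pair /= tnthS //.
  move=> [H0 H] i; case: (unliftP ord0 i) => [j ->|-> //].
  by rewrite tnthS; exact: H.
rewrite product_measure1E//; last first.
  rewrite [X in measurable X](_ : _ = \bigcap_(i in [set: 'I_d]) ((fun t => tnth t i) @^-1` F i.+1)).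
   apply: fin_bigcap_measurable => // i _.
   rewrite -[X in measurable X]setTI; exact: measurable_tnth.
  by apply/seteqP; split => t /= H i; [move=> _|]; exact: H.
rewrite big_ord_recl; congr (_ * _)%E.
by rewrite (IH (fun n => F n.+1)).
Qed.

Definition vec_of_pairs (R : realType) (d : nat) (t : d.-tuple (R * R)) :
    'cV[R[i]]_d :=
  \col_(j < d) ((tnth t j).1 +i* (tnth t j).2).

(* Main.v *)
(* With x = W^-1 y, completing the square in x turns left Schur invariance of
   B_L into the matrix equation Phi(W) = 0 together with the energy identity
     y^* B_L y - x^* B_L x = (x, y)^* A (x, y) > 0.
   If B_L is positive, this identity forces the eigenvalues of W outside the
   unit disk. Since W is diagonalizable and Phi(W) = 0, its eigenvectors are the
   u_w; they form a basis, so W has d distinct eigenvalues, and these exhaust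
   S_{>1} because z |-> 1 / conj z exchanges S_{<1} and S_{>1} while
   z^d det Phi(z) has degree at most 2 d. Conversely, if W is diagonal in
   (u_w)_{|w| > 1}, the skew part N of B_L solves N = W^* N W, hence vanishes,
   and summing the energy identity along W^-n y -> 0 gives positivity.
   The eigenvalue Lambda = alpha (2 pi)^d / det H, with H = B_L + A_LL = - A_LR W,
   is a Gaussian integral, computed by integrating out one coordinate at a time
   (Schur complements). Since prod_{S_{<1}} w = 1 / conj (det W) and det H is
   real, det H = (-1)^d det A_RL / prod_{S_{<1}} w. *)

Require Import Defs.
From HB Require Import structures.
From mathcomp Require Import all_boot all_order all_algebra.
From mathcomp Require Import sesquilinear spectral complex.
From mathcomp Require Import all_classical all_reals all_analysis.
From mathcomp Require Import perm measurable_realfun zify ring.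

Set Implicit Arguments.
Unset Strict Implicit.
Unset Printing Implicit Defensive.

Import Order.TTheory GRing.Theory Num.Theory.
Import numFieldNormedType.Exports.

Local Open Scope classical_set_scope.
Local Open Scope ring_scope.
Local Open Scope complex_scope.

(** * Adjoints and blocks *)

Section Adjoint.
Local Open Scope sesquilinear_scope.
Variable R : realType.
Local Notation C := R[i].

Lemma adjmxM (m n p : nat) (M : 'M[C]_(m, n)) (N : 'M[C]_(n, p)) :
  (M *m N)^t* = N^t* *m M^t*.
Proof. by rewrite trmx_mul map_mxM. Qed.

Lemma adjmxZ (m n : nat) (a : C) (M : 'M[C]_(m, n)) :
  (a *: M)^t* = Num.conj a *: M^t*.
Proof. by apply/matrixP => i j; rewrite !mxE rmorphM. Qed.

Lemma adjmxD (m n : nat) (M N : 'M[C]_(m, n)) : (M + N)^t* = M^t* + N^t*.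
Proof. by rewrite linearD map_mxD. Qed.

Lemma adjmxN (m n : nat) (M : 'M[C]_(m, n)) : (- M)^t* = - M^t*.
Proof. by rewrite linearN map_mxN. Qed.

Lemma adjmx_col (m n p : nat) (M : 'M[C]_(m, p)) (N : 'M[C]_(n, p)) :
  (col_mx M N)^t* = row_mx (M^t*) (N^t*).
Proof. by rewrite tr_col_mx map_row_mx. Qed.

Lemma hermsymmxP (n : nat) (M : 'M[C]_n) : reflect (M^t* = M) (M \is hermsymmx).
Proof.
apply: (iffP (is_hermitianmxP _ _ _)); rewrite expr0 scale1r;
  exact: esym.
Qed.

Lemma adjmx_eq0 (m n : nat) (M : 'M[C]_(m, n)) : (M^t* == 0) = (M == 0).
Proof.
apply/eqP/eqP => [M0|->]; last by rewrite trmx0 map_mx0.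
by rewrite -[M]trmxCK M0 trmx0 map_mx0.
Qed.

(** A singular matrix has a nonzero row [v] with [v *m M = 0], and the form vanishes at its
    adjoint. *)
Lemma posdefmx_unit (n : nat) (M : 'M[C]_n) : posdefmx M -> M \in unitmx.
Proof.
case=> _ Mpos; rewrite unitmxE unitfE; apply/det0P => -[v v0 vM].
have := Mpos (v^t*); rewrite adjmx_eq0 v0 trmxCK vM mul0mx mxE ltxx.
by move=> /(_ isT).
Qed.

Lemma posdefmxD (n : nat) (M N : 'M[C]_n) :
  posdefmx M -> posdefmx N -> posdefmx (M + N).
Proof.
move=> [/hermsymmxP hM pM] [/hermsymmxP hN pN]; split.
  by apply/hermsymmxP; rewrite adjmxD hM hN.
by move=> x x0; rewrite mulmxDr mulmxDl mxE addr_gt0 ?pM ?pN.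
Qed.

Section Blocks.
Variables (d : nat) (A : 'M[C]_(d + d)).
Hypothesis A_herm : A \is hermsymmx.

Lemma adj_A_LL : (A_LL A)^t* = A_LL A.
Proof. by rewrite -[in RHS](hermsymmxP _ A_herm) /A_LL trmx_ulsub map_ulsubmx. Qed.

Lemma adj_A_RR : (A_RR A)^t* = A_RR A.
Proof. by rewrite -[in RHS](hermsymmxP _ A_herm) /A_RR trmx_drsub map_drsubmx. Qed.

Lemma adj_A_LR : (A_LR A)^t* = A_RL A.
Proof. by rewrite /A_RL -[in RHS](hermsymmxP _ A_herm) /A_LR trmx_ursub map_dlsubmx. Qed.

Lemma adj_A_RL : (A_RL A)^t* = A_LR A.
Proof. by rewrite -adj_A_LR trmxCK. Qed.

(** Adjunction exchanges [A_LR] and [A_RL]; this is the source of the symmetry of the spectrum in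
    the unit circle. *)
Lemma adj_Phi (z : C) : (Phi A z)^t* = Phi A (Num.conj z)^-1.
Proof.
rewrite /Phi !adjmxD !adjmxZ adj_A_LL adj_A_RR adj_A_LR adj_A_RL invrK fmorphV.
by rewrite addrAC.
Qed.

End Blocks.

Lemma block_form (d : nat) (A : 'M[C]_(d + d)) (x y : 'cV[C]_d) :
  (col_mx x y)^t* *m A *m col_mx x y =
  x^t* *m (A_LL A *m x) + x^t* *m (A_LR A *m y)
  + (y^t* *m (A_RL A *m x) + y^t* *m (A_RR A *m y)).
Proof.
rewrite -[in LHS](submxK A) adjmx_col -mulmxA mul_block_col mul_row_col.
by rewrite !mulmxDr.
Qed.

Lemma posdefmx_A_LL (d : nat) (A : 'M[C]_(d + d)) :
  posdefmx A -> posdefmx (A_LL A).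
Proof.
move=> [hA pA]; split; first exact/hermsymmxP/adj_A_LL.
move=> x x0; have := pA (col_mx x 0); rewrite block_form !mulmx0 trmx0 map_mx0.
by rewrite !mul0mx !addr0 mulmxA; apply; rewrite col_mx_eq0 (negPf x0).
Qed.

End Adjoint.

(** * The spectrum of Phi *)

Section Spectrum.
Local Open Scope sesquilinear_scope.
Variables (R : realType) (d : nat) (A : 'M[R[i]]_(d + d)).
Local Notation C := R[i].
Hypothesis A_herm : A \is hermsymmx.
Hypothesis A_LR_unit : A_LR A \in unitmx.

Lemma A_RL_unit : A_RL A \in unitmx.
Proof. by rewrite -adj_A_LR // map_unitmx unitmx_tr. Qed.

Lemma spec_neq0 (w : C) : spec A w -> w != 0.
Proof. by case. Qed.

Lemma specP (w : C) (v : 'cV[C]_d) :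
  w != 0 -> v != 0 -> Phi A w *m v = 0 -> spec A w.
Proof.
move=> w0 v0 Pv; split=> //; apply/eqP/contraT => detN0.
have U : Phi A w \in unitmx by rewrite unitmxE unitfE.
by move: v0; rewrite -(mulKmx U v) Pv mulmx0 eqxx.
Qed.

(** Reflection in the unit circle; [0] is sent to itself, which makes it an involution of all of
    [C]. *)
Definition invconj (z : C) : C := (Num.conj z)^-1.

Lemma invconjK : involutive invconj.
Proof. by move=> z; rewrite /invconj fmorphV invrK; exact: conjCK. Qed.

Lemma invconj_spec (w : C) : spec A w -> spec A (invconj w).
Proof.
move=> [w0 dw]; split; first by rewrite invr_eq0 fmorph_eq0.
by rewrite -adj_Phi // det_map_mx det_tr dw rmorph0.
Qed.

Lemma norm_invconj (w : C) : `|invconj w| = `|w|^-1.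
Proof. by rewrite normfV norm_conjC. Qed.

Lemma invconj_gt1 (w : C) : spec_gt1 A w -> spec_lt1 A (invconj w).
Proof.
move=> [sw w1]; split; first exact: invconj_spec.
by rewrite norm_invconj invf_lt1 // (lt_trans ltr01).
Qed.

Lemma invconj_lt1 (w : C) : spec_lt1 A w -> spec_gt1 A (invconj w).
Proof.
move=> [sw w1]; split; first exact: invconj_spec.
by rewrite norm_invconj invf_gt1 // normr_gt0; exact: spec_neq0.
Qed.

(** The constant coefficient is [\det (A_RL A)]; its nonvanishing makes the polynomial nonzero, as
    the root count requires. *)
Lemma detPhi_poly0 : (detPhi_poly A).[0] != 0.
Proof.
rewrite -horner_evalE -det_map_mx.
have -> : map_mx (horner_eval 0) ('X *: map_mx polyC (A_LL A + A_RR A) +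
    'X^2 *: map_mx polyC (A_LR A) + map_mx polyC (A_RL A)) = A_RL A.
  apply/matrixP => i j; rewrite !mxE /= /horner_eval !hornerE.
  by rewrite ?expr0n ?mul0r ?add0r.
by rewrite -unitfE -unitmxE A_RL_unit.
Qed.

(** Each Leibniz term is a product of [d] entries of degree at most 2. *)
Lemma size_detPhi_poly : (size (detPhi_poly A) <= (d + d).+1)%N.
Proof.
rewrite /detPhi_poly; set M := (X in \det X).
have sM i j : (size (M i j) <= 3)%N.
  rewrite /M !mxE.
  apply: (leq_trans (size_polyD _ _)); rewrite geq_max.
  rewrite (leq_trans (size_polyC_leq1 _)) // andbT.
  apply: (leq_trans (size_polyD _ _)); rewrite geq_max.
  rewrite ![_ * _%:P]mulrC !mul_polyC.
  by rewrite !(leq_trans (size_scale_leq _ _)) ?size_polyX ?size_polyXn.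
apply: (leq_trans (size_sum _ _ _)); apply/bigmax_leqP => s _.
rewrite -polyC1 -rmorphN -rmorphXn mul_polyC /=.
apply: (leq_trans (size_scale_leq _ _)).
(* The size formula for a product asks for nonzero factors, so a vanishing entry is treated
   apart. *)
have [/existsP[i /eqP Mi0]|/existsPn MN0] := boolP [exists i, M i (s i) == 0].
  by rewrite (bigD1 i) //= Mi0 mul0r size_poly0.
rewrite size_prod => [|i _]; last exact: MN0.
rewrite leq_subLR card_ord (leq_trans (n := (\sum_(i < d) 3).+1)) //.
  by rewrite ltnS leq_sum.
by rewrite sum_nat_const card_ord addnS ltnS; lia.
Qed.

(* The d + d roots of detPhi_poly are exchanged by w |-> 1 / conj w. *)
Lemma size_spec_gt1 (s : seq C) :
  uniq s -> (forall w, w \in s -> spec_gt1 A w) -> (size s <= d)%N.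
Proof.
move=> us s1; have us' : uniq (s ++ map invconj s).
  rewrite cat_uniq us map_inj_uniq ?us ?andbT /=; last exact: (inv_inj invconjK).
  apply/hasPn => _ /mapP[w ws ->]; apply/negP => /s1 [_ ltw].
  by have [_ /(lt_trans ltw)] := invconj_gt1 (s1 _ ws); rewrite ltxx.
have p0 : detPhi_poly A != 0.
  by apply: contraNneq detPhi_poly0 => ->; rewrite horner0.
have rs : all (root (detPhi_poly A)) (s ++ map invconj s).
  have rw w : spec A w -> root (detPhi_poly A) w.
    by move=> [w0 dw]; rewrite /root detPhi_polyE // dw mulr0.
  apply/allP => w; rewrite mem_cat => /orP[/s1[/rw //]|/mapP[v vs ->]].
  by apply/rw/invconj_spec; have [] := s1 _ vs.
have := leq_trans (max_poly_roots p0 rs us') size_detPhi_poly.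
by rewrite size_cat size_map ltnS !addnn leq_double.
Qed.

End Spectrum.

(** * Matrix roots of Phi *)

Section Eigenvectors.
Variables (F : fieldType) (d : nat) (W : 'M[F]_d).
Hypothesis W_unit : W \in unitmx.

Lemma eigenvalue_neq0 (w : F) (v : 'cV[F]_d) : v != 0 -> W *m v = w *: v -> w != 0.
Proof.
move=> v0 Wv; apply: contraNneq v0 => w0; rewrite -(mulKmx W_unit v) Wv w0.
by rewrite scale0r mulmx0.
Qed.

Lemma invmx_eigenvector (w : F) (v : 'cV[F]_d) :
  w != 0 -> W *m v = w *: v -> invmx W *m v = w^-1 *: v.
Proof.
move=> w0 Wv; apply: (scalerI w0).
by rewrite scalerA divff // scale1r scalemxAr -Wv mulKmx.
Qed.

Lemma invmx_exp_eigenvector (n : nat) (w : F) (v : 'cV[F]_d) :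
  w != 0 -> W *m v = w *: v -> invmx W ^+ n *m v = w^-1 ^+ n *: v.
Proof.
move=> w0 Wv; elim: n => [|n IH]; first by rewrite !expr0 mul1mx scale1r.
rewrite exprSr -[_ * _]/(_ *m _) -mulmxA (invmx_eigenvector w0 Wv).
by rewrite -scalemxAr IH scalerA exprS.
Qed.

End Eigenvectors.

Section MatrixRoot.
Variables (R : realType) (d : nat) (A : 'M[R[i]]_(d + d)).
Local Notation C := R[i].

(* "Phi(W) = 0", with W substituted on the right of the coefficients. *)
Definition matrix_root (W : 'M[C]_d) : Prop :=
  A_LL A + A_RR A + A_LR A *m W + A_RL A *m invmx W = 0.

(** On an eigenvector of [W], Phi(W) acts as the symbol at the eigenvalue; this links matrix roots
    to the kernels spanned by the [u w]. *)
Lemma Phi_eigenvector (W : 'M[C]_d) (w : C) (v : 'cV[C]_d) :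
  W \in unitmx -> w != 0 -> W *m v = w *: v ->
  Phi A w *m v =
  (A_LL A + A_RR A + A_LR A *m W + A_RL A *m invmx W) *m v.
Proof.
move=> uW w0 Wv; rewrite /Phi !mulmxDl -!mulmxA Wv.
by rewrite (invmx_eigenvector uW w0 Wv) -!scalemxAl -!scalemxAr.
Qed.

(** Each eigenvector of [W] lies in a kernel of the symbol, so it is a multiple of some [u w].
    Independent eigenvectors therefore have distinct eigenvalues, and these [d] values fill S_{>1},
    which has at most [d] elements. *)
Lemma matrix_root_diagonal (u : C -> 'cV[C]_d) (W : 'M[C]_d) :
  A \is hermsymmx -> A_LR A \in unitmx -> spans_kernels A u ->
  W \in unitmx -> diagonalizable W -> matrix_root W ->
  (forall (w : C) (v : 'cV[C]_d), v != 0 -> W *m v = w *: v -> 1 < `|w|) ->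
  exists s : seq C,
    [/\ uniq s, spec_gt1 A = [set` s], basis_of {:'cV[C]_d} (map u s),
        forall w, w \in s -> W *m u w = w *: u w
      & \det W = \prod_(w <- s) w].
Proof.
move=> hA uP uker uW [V uV /(similar_diagLR uV)[D]]; rewrite conjVmx //.
(* In W = X diag(D) V the columns of [X] are eigenvectors, with eigenvalues [D 0 j]. *)
set X := invmx V => WE rW gt1.
have uX : X \in unitmx by rewrite unitmx_inv.
have col0 j : col j X != 0.
  rewrite colE; apply/eqP => /(congr1 (mulmx V)); rewrite mulKVmx // mulmx0.
  by move/matrixP/(_ j 0); rewrite !mxE !eqxx /= => /eqP; rewrite oner_eq0.
have Wcol j : W *m col j X = D 0 j *: col j X.
  rewrite WE !colE -!mulmxA mulKVmx // scalemxAr; congr (_ *m _).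
  rewrite mul_diag_mx; apply/matrixP => i k; rewrite !mxE.
  by have [->|_] := eqVneq i j; rewrite ?mulr0.
have Dgt1 j : spec_gt1 A (D 0 j).
  split; last exact: gt1 (col0 j) (Wcol j).
  have D0 := eigenvalue_neq0 uW (col0 j) (Wcol j).
  by apply: (specP D0 (col0 j)); rewrite (Phi_eigenvector uW D0 (Wcol j)) rW mul0mx.
have /choice[c colu] j : exists c, col j X = c *: u (D 0 j).
  have [sD _] := Dgt1 j; have [_ /(_ (col j X))[+ _]] := uker _ sD; apply.
  have D0 := spec_neq0 sD.
  by rewrite (Phi_eigenvector uW D0 (Wcol j)) rW mul0mx.
have c0 j : c j != 0.
  by apply: contraNneq (col0 j) => c0; rewrite colu c0 scale0r.
have Dinj : injective (D 0).
  move=> i j Dij; apply/eqP/contraT => ij.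
  (* Equal eigenvalues make columns i and j proportional; [V] maps them to distinct standard basis
     vectors, which forces [c j = 0]. *)
  have /(congr1 (mulmx V)) : c j *: col i X = c i *: col j X.
    by rewrite !colu Dij !scalerA mulrC.
  rewrite -!scalemxAr !colE !mulKVmx // => /matrixP/(_ i 0).
  by rewrite !mxE !eqxx (negPf ij) /= mulr1 mulr0 => /eqP; rewrite (negPf (c0 j)).
pose s := [seq D 0 j | j <- enum 'I_d].
have ss : size s = d by rewrite size_map size_enum_ord.
have us : uniq s by rewrite map_inj_uniq ?enum_uniq.
have s1 w : w \in s -> spec_gt1 A w by move=> /mapP[j _ ->].
exists s; split => //.
- apply/seteqP; split => w /=; last exact: s1.
  move=> w1; apply/contraT => ws.
  have : (size (w :: s) <= d)%N.
    apply: (size_spec_gt1 hA uP); first by rewrite /= ws.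
    by move=> z; rewrite inE => /orP[/eqP->|/s1].
  by rewrite /= ss ltnn.
- rewrite basisEdim size_map ss dimvf dim_matrix -[X in (_ <= X)%N]/(d * 1)%N.
  rewrite muln1 leqnn andbT.
  apply/subvP => v _; rewrite -(mulKVmx uX v).
  have -> (y : 'cV[C]_d) : X *m y = \sum_j y j 0 *: col j X.
    apply/matrixP => i k; rewrite [k]ord1 summxE !mxE.
    by apply: eq_bigr => j _; rewrite !mxE mulrC.
  apply: memv_suml => j _; rewrite colu scalerA; apply/memvZ/memv_span.
  by apply/map_f/map_f; rewrite mem_enum.
- move=> _ /mapP[j _ ->]; apply: (scalerI (c0 j)).
  by rewrite scalemxAr -colu Wcol colu !scalerA mulrC.
- rewrite WE !det_mulmx mulrAC -det_mulmx mulVmx // det1 mul1r det_diag.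
  by rewrite big_map big_enum.
Qed.

End MatrixRoot.

(** * Convergence to zero *)

Section NullSequences.
Variable R : realType.
Local Notation C := R[i].

(** [C] is normed over itself, so the tolerances are complex numbers, positive and thus real. *)
Lemma cvg0P (f : nat -> C) :
  (f : nat -> C^o) @ \oo --> (0 : C^o) <->
  forall e : C, 0 < e -> \forall n \near \oo, `|f n| < e.
Proof.
split=> [/cvgrPdist_lt f0 e /f0|f0]; first by apply: filterS => n; rewrite sub0r normrN.
by apply/cvgrPdist_lt => e /f0; apply: filterS => n; rewrite sub0r normrN.
Qed.

Lemma cvg0_expr (z : C) : `|z| < 1 -> (fun n => z ^+ n : C^o) @ \oo --> (0 : C^o).
Proof.
move=> z1; apply/cvg0P => e e0.
(* The modulus is itself an element of [C]; the real geometric sequence is applied to its real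
   part. *)
have rE : (complex.Re `|z|)%:C = `|z| by rewrite RRe_real // normr_real.
have eE : (complex.Re e)%:C = e by rewrite RRe_real // gtr0_real.
have r0 : 0 <= complex.Re `|z| by rewrite -lecR rE; exact: normr_ge0.
have /cvg_expr/cvgrPdist_lt/(_ (complex.Re e)) : `|complex.Re `|z| | < 1.
  by rewrite ger0_norm // -ltcR rE.
rewrite -ltcR eE => /(_ e0); apply: filterS => n.
by rewrite sub0r normrN ger0_norm ?exprn_ge0 // -ltcR rmorphXn /= rE eE normrX.
Qed.

Lemma cvg0_conj (f : nat -> C) : (f : nat -> C^o) @ \oo --> (0 : C^o) ->
  (fun n => Num.conj (f n) : C^o) @ \oo --> (0 : C^o).
Proof.
by move=> /cvg0P f0; apply/cvg0P => e /f0; apply: filterS => n; rewrite norm_conjC.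
Qed.

Lemma cvg0_mull (a : C) (f : nat -> C) : (f : nat -> C^o) @ \oo --> (0 : C^o) ->
  (fun n => a * f n : C^o) @ \oo --> (0 : C^o).
Proof. by move=> f0; rewrite -[X in _ --> X](mulr0 a); apply: cvgMr. Qed.

Lemma cvg0_sum (I : finType) (f : I -> nat -> C) :
  (forall i, (f i : nat -> C^o) @ \oo --> (0 : C^o)) ->
  (fun n => \sum_i f i n : C^o) @ \oo --> (0 : C^o).
Proof.
move=> f0.
suff : (fun n => \sum_i f i n : C^o) @ \oo --> (\sum_(i : I) 0 : C^o) by rewrite big1.
by apply: cvg_big => //; exact: add_continuous.
Qed.

Lemma cvg0_col (d : nat) (f : nat -> 'cV[C]_d) :
  (f : nat -> 'cV[C^o]_d) @ \oo --> (0 : 'cV[C^o]_d) <->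
  forall i, (fun n => f n i 0 : C^o) @ \oo --> (0 : C^o).
Proof.
split=> [/cvg_ballP f0 i|f0].
  apply/cvg_ballP => e /f0; apply: filterS => n [_ /(_ i 0)]; by rewrite mxE.
apply/cvg_ballP => e e0.
have : \forall n \near \oo, forall i, ball (0 : C^o) e (f n i 0 : C^o).
  by apply: filter_forall => i; have /cvg_ballP/(_ e e0) := f0 i.
by apply: filterS => n fn; split=> // i j; rewrite [j]ord1 mxE.
Qed.

Lemma cvg0_form (d : nat) (B : 'M[C]_d) (f : nat -> 'cV[C]_d) :
  (forall i, (fun n => f n i 0 : C^o) @ \oo --> (0 : C^o)) ->
  (fun n => ((map_mx Num.conj (f n)^T) *m B *m f n) 0 0 : C^o) @ \oo --> (0 : C^o).
Proof.
move=> f0.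
have -> : (fun n => ((map_mx Num.conj (f n)^T) *m B *m f n) 0 0 : C^o) =
    (fun n => \sum_k (\sum_j B j k * Num.conj (f n j 0)) * f n k 0 : C^o).
  apply/funext => n; rewrite !mxE; apply: eq_bigr => k _; rewrite !mxE.
  by congr (_ * _); apply: eq_bigr => j _; rewrite !mxE mulrC.
apply: cvg0_sum => k; rewrite -[X in _ --> X](mulr0 (0 : C^o)).
by apply: cvgM; [apply: cvg0_sum => j; exact/cvg0_mull/cvg0_conj|exact: f0].
Qed.

End NullSequences.

(** * Matrices diagonal in a basis, with eigenvalues outside the unit disk *)

Section EigenBasis.
Local Open Scope sesquilinear_scope.
Variables (R : realType) (d : nat) (D : set R[i]) (u : R[i] -> 'cV[R[i]]_d).
Local Notation C := R[i].
Hypothesis u_basis : basis_family D u.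

(** Induction along the coordinate expansion; it serves for vanishing as well as for convergence to
    zero. *)
Lemma basis_family_ind (P : 'cV[C]_d -> Prop) :
  P 0 -> (forall a v v', P v -> P v' -> P (a *: v + v')) ->
  (forall w, D w -> P (u w)) -> forall x, P x.
Proof.
move=> P0 PD Pu x; have [s [us DE bs]] := u_basis.
have -> := @coord_basis _ _ _ _ (in_tuple (map u s)) x bs (memvf x).
elim/big_rec: _ => // i v _ Pv; apply: PD => //.
have : (in_tuple [seq u w | w <- s])`_i \in map u s by rewrite mem_nth.
by case/mapP => w ws ->; apply: Pu; rewrite DE.
Qed.

Lemma basis_family_eq0 (m : nat) (N : 'M[C]_(m, d)) : (forall w, D w -> N *m u w = 0) -> N = 0.
Proof.
move=> Nu; have N0 (x : 'cV[C]_d) : N *m x = 0.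
  elim/basis_family_ind: x => [|a v v' Nv Nv'|]; rewrite ?mulmx0 //.
  by rewrite mulmxDr -scalemxAr Nv Nv' scaler0 addr0.
by apply/matrixP => i j; have /matrixP/(_ i 0) := N0 (delta_mx j 0); rewrite -colE !mxE.
Qed.

Hypothesis D_gt1 : forall w, D w -> 1 < `|w|.
Variable W : 'M[C]_d.
Hypothesis W_diag : forall w, D w -> W *m u w = w *: u w.

(** Between [u w] and [u w'] the equation multiplies the entry of [N] by conj(w) w', of modulus
    greater than 1, so each entry vanishes. *)
Lemma stein_eq0 (N : 'M[C]_d) : N = W^t* *m N *m W -> N = 0.
Proof.
move=> NE; apply: basis_family_eq0 => w' Dw'.
(* The adjoint moves the free side of [N *m u w'] to the right, where the basis criterion applies
   again. *)
apply/eqP; rewrite -adjmx_eq0; apply/eqP/basis_family_eq0 => w Dw.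
apply/eqP; rewrite -adjmx_eq0 adjmxM trmxCK.
have wN1 : 1 - Num.conj w * w' != 0.
  rewrite subr_eq0; apply/eqP => /(congr1 Num.norm)/esym/eqP.
  by rewrite normr1 normrM norm_conjC gt_eqF // mulr_egt1 ?D_gt1.
have /eqP : (1 - Num.conj w * w') *: ((u w)^t* *m (N *m u w')) = 0.
  rewrite scalerBl scale1r {1}NE -!mulmxA W_diag // -!scalemxAr (mulmxA _ (W^t*)) -adjmxM.
  by rewrite W_diag // adjmxZ -scalemxAl scalerA [w' * _]mulrC subrr.
by rewrite scaler_eq0 (negPf wN1).
Qed.

Hypothesis W_unit : W \in unitmx.

(** On [u w] the powers act as w^-n, a null geometric sequence because |w| > 1. *)
Lemma invmx_powers_cvg0 (x : 'cV[C]_d) (i : 'I_d) :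
  (fun n => (invmx W ^+ n *m x) i 0 : C^o) @ \oo --> (0 : C^o).
Proof.
elim/basis_family_ind: x => [|a v v' Pv Pv'|w Dw].
- rewrite (_ : (fun n => _) = (fun=> 0 : C^o)); first exact: cvg_cst.
  by apply/funext => n; rewrite mulmx0 mxE.
- rewrite (_ : (fun n => _) = (fun n => a * (invmx W ^+ n *m v) i 0
    + (invmx W ^+ n *m v') i 0 : C^o)); last first.
    by apply/funext => n; rewrite mulmxDr -scalemxAr !mxE.
  rewrite -[X in _ --> X]/(0 : C^o) -(addr0 (0 : C^o)).
  exact: cvgD (cvg0_mull a Pv) Pv'.
have w1 := D_gt1 Dw; have w0 : w != 0.
  by rewrite -normr_gt0 (lt_trans ltr01).
rewrite (_ : (fun n => _) = (fun n => u w i 0 * w^-1 ^+ n : C^o)); last first.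
  apply/funext => n.
  by rewrite (invmx_exp_eigenvector W_unit n w0 (W_diag Dw)) mxE mulrC.
apply/cvg0_mull/cvg0_expr; rewrite normfV invf_lt1 //.
exact: lt_trans w1.
Qed.

End EigenBasis.

(** * Schur invariance and energy *)

Section SchurInvariance.
Local Open Scope sesquilinear_scope.

Lemma hermsymmx_form_real (R : realType) (n : nat) (M : 'M[R[i]]_n) (x : 'cV[R[i]]_n) :
  M \is hermsymmx -> (x^t* *m M *m x) 0 0 \is Num.real.
Proof.
move=> /hermsymmxP hM; rewrite CrealE; apply/eqP.
have /matrixP/(_ 0 0) : (x^t* *m M *m x)^t* = x^t* *m M *m x.
  by rewrite !adjmxM trmxCK hM mulmxA.
by rewrite [in LHS]mxE [in LHS]mxE.
Qed.

Variables (R : realType) (d : nat) (A : 'M[R[i]]_(d + d)) (W : 'M[R[i]]_d).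
Local Notation C := R[i].
Hypotheses (A_pos : posdefmx A) (A_LR_unit : A_LR A \in unitmx).
Hypothesis W_unit : W \in unitmx.
Local Notation B := (A_RR A + A_RL A *m invmx W).

Let A_herm : A \is hermsymmx. Proof. by case: A_pos. Qed.

(** [B + A_LL A] is the matrix inverted in the Schur equation; a matrix root gives it in factored
    form. *)
Lemma matrix_rootE : matrix_root A W <-> B + A_LL A = - (A_LR A *m W).
Proof.
rewrite /matrix_root.
have -> : A_LL A + A_RR A + A_LR A *m W + A_RL A *m invmx W =
    B + A_LL A + A_LR A *m W.
  by rewrite addrAC [A_LL A + _]addrC; congr (_ + _); rewrite addrAC.
by split=> [/eqP|->]; [rewrite addr_eq0 => /eqP|rewrite addNr].
Qed.

(** Cancelling [A_RR] and then the invertible [A_RL] in the Schur equation gives W^-1 = - H^-1 A_LR,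
    with H = B + A_LL. *)
Lemma schur_matrix_root : left_schur_invariant A B -> matrix_root A W.
Proof.
move=> [pB BE]; have uH := posdefmx_unit (posdefmxD pB (posdefmx_A_LL A_pos)).
set H := B + A_LL A in BE uH; have uQ := A_RL_unit A_herm A_LR_unit.
have WiE : invmx W = - (invmx H *m A_LR A).
  apply: (can_inj (mulKmx uQ)); apply: (addrI (A_RR A)).
  by rewrite BE mulmxN mulmxA.
apply/matrix_rootE; rewrite -/H -[LHS](mulmxKV W_unit) -mulNmx; congr (_ *m _).
by rewrite WiE mulmxN mulKVmx.
Qed.

Lemma matrix_root_schur : matrix_root A W -> posdefmx B -> left_schur_invariant A B.
Proof.
move=> rW pB; split=> //; have uH := posdefmx_unit (posdefmxD pB (posdefmx_A_LL A_pos)).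
rewrite (matrix_rootE.1 rW) in uH *; congr (_ + _); rewrite -mulmxN -mulmxA.
congr (_ *m _); apply: (can_inj (mulKmx uH)); rewrite mulKVmx //.
by rewrite mulNmx mulmxK.
Qed.

(** With x = W^-1 y, the two block rows of A (x, y) are - B x and B y. *)
Lemma energy_identity (y : 'cV[C]_d) : matrix_root A W ->
  (col_mx (invmx W *m y) y)^t* *m A *m col_mx (invmx W *m y) y =
  y^t* *m B *m y - (invmx W *m y)^t* *m B *m (invmx W *m y).
Proof.
move=> rW; rewrite block_form; set x := invmx W *m y.
have By : B *m y = A_RL A *m x + A_RR A *m y by rewrite mulmxDl addrC mulmxA.
have Bx : B *m x = - (A_LL A *m x + A_LR A *m y).
  apply/eqP; rewrite -addr_eq0 addrA -mulmxDl (matrix_rootE.1 rW).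
  by rewrite mulNmx -mulmxA mulKVmx // addNr.
rewrite -(mulmxA (y^t*) B) By -(mulmxA (x^t*) B) Bx mulmxN opprK !mulmxDr.
exact: addrC.
Qed.

Lemma energy_gt0 (y : 'cV[C]_d) : matrix_root A W -> y != 0 ->
  ((invmx W *m y)^t* *m B *m (invmx W *m y)) 0 0 < (y^t* *m B *m y) 0 0.
Proof.
move=> rW y0; have [_ pA] := A_pos.
have := pA (col_mx (invmx W *m y) y); rewrite energy_identity // !mxE subr_gt0.
by apply; rewrite col_mx_eq0 (negPf y0) andbF.
Qed.

(** On an eigenvector the energy inequality reads |w|^-2 q < q, where q > 0 is the value of the form
    of B. *)
Lemma schur_eigenvalue_gt1 (w : C) (v : 'cV[C]_d) :
  left_schur_invariant A B -> v != 0 -> W *m v = w *: v -> 1 < `|w|.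
Proof.
move=> sB v0 Wv; have rW := schur_matrix_root sB; have [[_ pB] _] := sB.
have w0 := eigenvalue_neq0 W_unit v0 Wv.
have := energy_gt0 rW v0; rewrite (invmx_eigenvector W_unit w0 Wv).
rewrite adjmxZ -!scalemxAl -scalemxAr scalerA mxE.
rewrite gtr_pMl ?pB // mulrC -normCK normfV expr_lt1 ?invr_ge0 //.
by rewrite invf_lt1 ?normr_gt0.
Qed.

(** The energy of W^-n y strictly decreases and tends to 0, so it starts positive. *)
Lemma posdefmx_of_decay : matrix_root A W -> B \is hermsymmx ->
  (forall (x : 'cV[C]_d) i,
    (fun n => (invmx W ^+ n *m x) i 0 : C^o) @ \oo --> (0 : C^o)) ->
  posdefmx B.
Proof.
move=> rW hB decay; split=> // y y0.
pose x n := invmx W ^+ n *m y.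
pose q n := ((x n)^t* *m B *m x n) 0 0.
have xS n : x n.+1 = invmx W *m x n by rewrite /x exprS mulmxA.
have x0 n : x n != 0.
  elim: n => [|n IH]; first by rewrite /x expr0 mul1mx.
  rewrite xS; apply: contraNneq IH => E.
  by rewrite -(mulKVmx W_unit (x n)) E mulmx0.
have qS n : q n.+1 < q n by rewrite /q xS; exact: energy_gt0.
have qreal n : q n \is Num.real by exact: hermsymmx_form_real.
(* With the first drop as tolerance, a late term gives [q 1 - q 0 < q N.+1 <= q 1], and so
   [0 < q 0]. *)
have /cvg0P/(_ (q 0 - q 1)) : (fun n => q n : C^o) @ \oo --> (0 : C^o).
  by apply: cvg0_form => i; exact: decay.
rewrite subr_gt0 => /(_ (qS 0%N)) [N _ qN].
have q1 n : q n.+1 <= q 1.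
  by elim: n => [|n IH]; [exact: lexx|exact: le_trans (ltW (qS _)) IH].
have := qN N.+1 (leqnSn N); rewrite real_ltr_norml ?qreal // opprB => /andP[+ _].
rewrite ltrBlDr => /lt_le_trans - /(_ _ (lerD (q1 N) (lexx _))).
rewrite ltrDl; have -> : q 0 = (y^t* *m B *m y) 0 0 by rewrite /q /x expr0 mul1mx.
by [].
Qed.

(* The skew part of A_RL W^-1 solves the Stein equation N = W^* N W. *)
Lemma matrix_root_herm : matrix_root A W ->
  (forall N : 'M[C]_d, N = W^t* *m N *m W -> N = 0) -> B \is hermsymmx.
Proof.
move=> rW stein; set X := A_RL A *m invmx W.
have QE : A_RL A = X *m W by rewrite mulmxKV.
have PE : A_LR A = W^t* *m X^t* by rewrite -adjmxM -QE adj_A_RL.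
(* With both off-diagonal blocks written through [X], the root equation and its adjoint differ by
   exchanging [X] and its adjoint; their difference is the Stein equation. *)
have e1 : A_LL A + A_RR A + W^t* *m X^t* *m W + X = 0 by rewrite -PE.
have e2 : A_LL A + A_RR A + W^t* *m X *m W + X^t* = 0.
  have /(congr1 (fun M => M^t*)) := e1.
  rewrite !adjmxD !adjmxM !trmxCK adj_A_LL // adj_A_RR // mulmxA => ->.
  by rewrite trmx0 map_mx0.
have XX : X - X^t* = 0.
  apply: stein; rewrite mulmxBr mulmxBl.
  have -> : X - X^t* = - (A_LL A + A_RR A + W^t* *m X^t* *m W)
      - - (A_LL A + A_RR A + W^t* *m X *m W).
    by congr (_ - _); apply/esym/addr0_eq.
  by rewrite opprK opprD addrACA addNr add0r addrC.
by apply/hermsymmxP; rewrite adjmxD adj_A_RR //; congr (_ + _); apply/esym/subr0_eq.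
Qed.

End SchurInvariance.

(** * Gaussian integrals *)

Section ComplexMeasurability.
Context {disp : measure_display} (T : measurableType disp) (R : realType).
Local Notation C := R[i].

(** Taking the two parts separately reduces everything to measurability of real functions. *)
Definition cmeasurable (f : T -> C) : Prop :=
  measurable_fun setT (fun t => complex.Re (f t)) /\
  measurable_fun setT (fun t => complex.Im (f t)).

Lemma cmeasurable_cst (c : C) : cmeasurable (fun=> c).
Proof. by split; exact: measurable_cst. Qed.

Lemma cmeasurableD (f g : T -> C) :
  cmeasurable f -> cmeasurable g -> cmeasurable (fun t => f t + g t).
Proof.
move=> [rf jf] [rg jg]; split.
  rewrite (_ : (fun t => _) = (fun t => complex.Re (f t) + complex.Re (g t))).
    exact: measurable_funD.
  by apply/funext => t; case: (f t); case: (g t).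
rewrite (_ : (fun t => _) = (fun t => complex.Im (f t) + complex.Im (g t))).
  exact: measurable_funD.
by apply/funext => t; case: (f t); case: (g t).
Qed.

Lemma cmeasurableM (f g : T -> C) :
  cmeasurable f -> cmeasurable g -> cmeasurable (fun t => f t * g t).
Proof.
move=> [rf jf] [rg jg]; split.
  rewrite (_ : (fun t => _) = (fun t => complex.Re (f t) * complex.Re (g t)
    - complex.Im (f t) * complex.Im (g t))).
    by apply: measurable_funB; exact: measurable_funM.
  by apply/funext => t; case: (f t); case: (g t).
rewrite (_ : (fun t => _) = (fun t => complex.Re (f t) * complex.Im (g t)
    + complex.Im (f t) * complex.Re (g t))).
  by apply: measurable_funD; exact: measurable_funM.
by apply/funext => t; case: (f t); case: (g t).
Qed.

Lemma cmeasurable_conj (f : T -> C) :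
  cmeasurable f -> cmeasurable (fun t => Num.conj (f t)).
Proof.
move=> [rf jf]; split.
  rewrite (_ : (fun t => _) = (fun t => complex.Re (f t))) //.
  by apply/funext => t; case: (f t).
rewrite (_ : (fun t => _) = (fun t => - complex.Im (f t))).
  exact: measurable_funN.
by apply/funext => t; case: (f t).
Qed.

Lemma cmeasurable_sum (I : finType) (f : I -> T -> C) :
  (forall i, cmeasurable (f i)) -> cmeasurable (fun t => \sum_i f i t).
Proof.
move=> mf; rewrite (_ : (fun t => _) = \sum_i f i); last first.
  by apply/funext => t; rewrite fct_sumE.
apply: (big_ind cmeasurable) => [|g h mg mh|i _]; last exact: mf.
  exact: cmeasurable_cst.
exact: cmeasurableD.
Qed.

Lemma measurable_quad_form (d : nat) (M : 'M[C]_d) (x : T -> 'cV[C]_d) :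
  (forall i, cmeasurable (fun t => x t i 0)) ->
  measurable_fun setT (fun t => quad_form M (x t)).
Proof.
move=> mx; suff [] : cmeasurable (fun t => ((map_mx Num.conj (x t)^T) *m M *m x t) 0 0) by [].
rewrite (_ : (fun t => _) =
    (fun t => \sum_k (\sum_j Num.conj (x t j 0) * M j k) * x t k 0)); last first.
  apply/funext => t; rewrite !mxE; apply: eq_bigr => k _; rewrite !mxE.
  by congr (_ * _); apply: eq_bigr => j _; rewrite !mxE.
apply: cmeasurable_sum => k; apply: cmeasurableM => //.
apply: cmeasurable_sum => j; apply: cmeasurableM; last exact: cmeasurable_cst.
exact: cmeasurable_conj.
Qed.

End ComplexMeasurability.

(** * Gaussian integrals in one real and in one complex variable *)

Section GaussianIntegral.
Local Open Scope sesquilinear_scope.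
Variable R : realType.
Local Notation C := R[i].
Local Notation mu := (@lebesgue_measure R).

(** The integrand is the normal density of mean [m] and variance 1/r, divided by its peak value. *)
Lemma integral_gauss1 (r m : R) : 0 < r ->
  (\int[mu]_x (expR (- (2^-1 * (r * (x - m) ^+ 2))))%:E = (Num.sqrt (2 * pi / r))%:E)%E.
Proof.
move=> r0; pose s := Num.sqrt r^-1.
have s0 : s != 0 by rewrite sqrtr_eq0 -ltNge invr_gt0.
have s2 : s ^+ 2 = r^-1 by rewrite sqr_sqrtr // invr_ge0 ltW.
have peak_gt0 := normal_peak_gt0 s0.
have peakE : (normal_peak s)^-1 = Num.sqrt (2 * pi / r).
  by rewrite /normal_peak invrK s2 -mulr_natl; congr Num.sqrt; field; rewrite gt_eqF.
have funE x : normal_fun m s x = expR (- (2^-1 * (r * (x - m) ^+ 2))).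
  by rewrite /normal_fun s2; congr expR; field; rewrite gt_eqF.
have := integral_normal_pdf m s; rewrite normal_pdfE //.
move=> /(congr1 (fun z => (normal_peak s)^-1%:E * z)%E).
rewrite mule1 peakE => <-; rewrite -peakE -ge0_integralZl //=; first last.
- by rewrite lee_fin invr_ge0 ltW.
- by move=> x _; rewrite lee_fin mulr_ge0 // ?expR_ge0 ?ltW.
- apply/measurable_EFinP/measurable_funM => //; exact: measurable_normal_fun.
by apply: eq_integral => x _; rewrite -EFinM mulKf ?gt_eqF // funE.
Qed.

(** The squared modulus separates real and imaginary parts, so Tonelli gives the square of the
    one-dimensional value. *)
Lemma integral_gauss2 (r : R) (m : C) : 0 < r ->
  (\int[sfprod mu mu]_p
     (expR (- (2^-1 * (r *
       complex.Re (Num.conj ((p.1 +i* p.2) - m) * ((p.1 +i* p.2) - m))))))%:E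
   = (2 * pi / r)%:E)%E.
Proof.
move=> r0; case: m => m1 m2.
pose g (m x : R) := expR (- (2^-1 * (r * (x - m) ^+ 2))).
have mg m : measurable_fun setT (g m).
  apply: measurableT_comp => //; apply: measurable_funN; do 2 apply: measurable_funM => //.
  by apply: measurable_funX; apply: measurable_funB.
transitivity (\int[mu \x mu]_p (g m1 p.1 * g m2 p.2)%:E)%E.
  apply: eq_integral => -[x y] _ /=; rewrite /g -expRD; congr (expR _)%:E.
  by field.
rewrite fubini_tonelli1 //=; first last.
- by move=> p; rewrite lee_fin mulr_ge0 ?expR_ge0.
- apply/measurable_EFinP/measurable_funM.
    by apply: measurableT_comp (mg m1) _; exact: measurable_fst.
  by apply: measurableT_comp (mg m2) _; exact: measurable_snd.
transitivity (\int[mu]_x ((Num.sqrt (2 * pi / r))%:E * (g m1 x)%:E))%E.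
  apply: eq_integral => x _; rewrite /fubini_F /=.
  under eq_integral do rewrite EFinM.
  rewrite ge0_integralZl //=.
  - by rewrite muleC; congr (_ * _)%E; exact: integral_gauss1.
  - by apply/measurable_EFinP; exact: mg.
  - by move=> y _; rewrite lee_fin expR_ge0.
  - by rewrite lee_fin expR_ge0.
rewrite ge0_integralZl //=; last 2 first.
- by apply/measurable_EFinP; exact: mg.
- by move=> y _; rewrite lee_fin expR_ge0.
rewrite integral_gauss1 // -EFinM -expr2 sqr_sqrtr //.
by rewrite divr_ge0 ?mulr_ge0 ?pi_ge0 // ltW.
Qed.

End GaussianIntegral.

(** * Schur complement of the first diagonal entry *)

Section SchurComplement.
Local Open Scope sesquilinear_scope.
Variables (R : realType) (n : nat) (H : 'M[R[i]]_(1 + n)).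
Local Notation C := R[i].
Hypothesis H_pos : posdefmx H.

Definition pivot : C := ulsubmx H 0 0.
(** For Hermitian [H] the adjoint of the lower left block is the upper right one, so this is the
    usual Schur complement. *)
Definition schur_compl : 'M[C]_n :=
  drsubmx H - pivot^-1 *: (dlsubmx H *m (dlsubmx H)^t*).

Let ursubH : ursubmx H = (dlsubmx H)^t*.
Proof.
have [/hermsymmxP hH _] := H_pos.
by rewrite -[in LHS]hH trmx_dlsub map_ursubmx.
Qed.

Let HE : H = block_mx pivot%:M ((dlsubmx H)^t*) (dlsubmx H) (drsubmx H).
Proof. by rewrite -[LHS]submxK ursubH [ulsubmx H]mx11_scalar. Qed.

Lemma pivot_gt0 : 0 < pivot.
Proof.
have one0 : (1%:M : 'M[C]_1) != 0.
  by apply/eqP => /matrixP/(_ 0 0)/eqP; rewrite !mxE eqxx oner_eq0.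
have [_ /(_ (col_mx 1%:M 0))] := H_pos.
rewrite col_mx_eq0 negb_and one0 => /(_ isT).
rewrite {1}HE adjmx_col mul_row_block mul_row_col !mulmx0 addr0 mulmx1.
by rewrite trmx0 map_mx0 mul0mx addr0 trmx1 map_mx1 mul1mx !mxE eqxx mulr1n.
Qed.

Let pivot_neq0 : pivot != 0. Proof. by rewrite gt_eqF // pivot_gt0. Qed.

Let conj_pivotV : Num.conj pivot^-1 = pivot^-1.
Proof. by apply/CrealP; rewrite realV gtr0_real ?pivot_gt0. Qed.

(** Completes the square in the first coordinate: [m] is this coordinate measured from the minimizer
    for fixed [y]. *)
Lemma schur_form (z : C) (y : 'cV[C]_n) :
  let m := z + pivot^-1 * ((dlsubmx H)^t* *m y) 0 0 in
  ((col_mx z%:M y)^t* *m H *m col_mx z%:M y) 0 0 =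
  pivot * (Num.conj m * m) + (y^t* *m schur_compl *m y) 0 0.
Proof.
move=> m; pose b := ((dlsubmx H)^t* *m y) 0 0.
have bE : (dlsubmx H)^t* *m y = b%:M by rewrite [LHS]mx11_scalar.
have bJ : y^t* *m dlsubmx H = (Num.conj b)%:M.
  rewrite -[dlsubmx H]trmxCK -adjmxM bE; apply/matrixP => i j.
  by rewrite !mxE !ord1 !mulr1n.
rewrite {1}HE adjmx_col -mulmxA mul_block_col mul_row_col bE.
rewrite !mulmxDr [y^t* *m (dlsubmx H *m _)]mulmxA bJ.
rewrite /schur_compl mulmxDl mulmxN mulNmx -scalemxAr -scalemxAl.
rewrite (mulmxA (y^t*) (dlsubmx H)) bJ -(mulmxA _%:M) bE -(mulmxA (y^t*)).
set k := y^t* *m _.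
have -> : (z%:M : 'M[C]_1)^t* = (Num.conj z)%:M.
  by apply/matrixP => i j; rewrite !mxE !ord1 !mulr1n.
rewrite -!scalar_mxM !mxE !eqxx !mulr1n.
have -> : Num.conj m = Num.conj z + pivot^-1 * Num.conj b.
  by rewrite /m rmorphD rmorphM; congr (_ + _ * _); exact: conj_pivotV.
by rewrite /m -/b; field.
Qed.

Lemma schur_compl_posdef : posdefmx schur_compl.
Proof.
have [/hermsymmxP hH pH] := H_pos; split.
  apply/hermsymmxP; rewrite /schur_compl adjmxD adjmxN adjmxZ adjmxM trmxCK.
  by rewrite conj_pivotV -[in RHS]hH trmx_drsub map_drsubmx hH.
(* This first coordinate makes the completed square vanish. *)
move=> y y0; have := schur_form (- (pivot^-1 * ((dlsubmx H)^t* *m y) 0 0)) y.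
rewrite /= addNr mulr0 mulr0 add0r => <-; apply: pH.
by rewrite col_mx_eq0 (negPf y0) andbF.
Qed.

(** Right multiplication by a unipotent block matrix clears the upper right block. *)
Lemma det_schur : \det H = pivot * \det schur_compl.
Proof.
have := det_mulmx H (block_mx 1%:M (- (pivot^-1 *: (dlsubmx H)^t*)) 0 1%:M).
rewrite det_ublock !det1 !mulr1 => <-; rewrite {1}HE mulmx_block.
rewrite !mulmx1 !mulmx0 !addr0 mul_scalar_mx scalerN scalerA divff // scale1r addNr.
by rewrite mulmxN -scalemxAr addrC det_lblock det_scalar expr1.
Qed.

End SchurComplement.

(** * Gaussian integrals over C^n *)

Section GaussianIntegralCn.
Local Open Scope sesquilinear_scope.
Variable R : realType.
Local Notation C := R[i].

Local Notation mu := (@lebesgue_measure R).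

Lemma cmeasurable_vec_of_pairs (n : nat) (c : 'cV[C]_n) (i : 'I_n) :
  cmeasurable (fun t : n.-tuple (measurableTypeR R * measurableTypeR R)%type =>
    (vec_of_pairs t - c) i 0).
Proof.
rewrite (_ : (fun t => _) = fun t => ((tnth t i).1 +i* (tnth t i).2) + - c i 0); last first.
  by apply/funext => t; rewrite !mxE.
apply: cmeasurableD; last exact: cmeasurable_cst.
split => /=.
  by apply: measurableT_comp measurable_fst _; exact: measurable_tnth.
by apply: measurableT_comp measurable_snd _; exact: measurable_tnth.
Qed.

Lemma measurable_gauss (n : nat) (H : 'M[C]_n) (c : 'cV[C]_n) :
  measurable_fun setT
    (fun t : n.-tuple (measurableTypeR R * measurableTypeR R)%type =>
      (expR (- (2^-1 * quad_form H (vec_of_pairs t - c))))%:E).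
Proof.
apply/measurable_EFinP; apply: measurableT_comp => //; apply: measurable_funN.
apply: measurable_funM => //; apply: measurable_quad_form => i.
exact: cmeasurable_vec_of_pairs.
Qed.

Lemma vec_of_pairs_cons (n : nat) (c : 'cV[C]_(1 + n)) p (t : n.-tuple (R * R)) :
  vec_of_pairs (cons_pair (p, t)) - c =
  col_mx ((p.1 +i* p.2) - usubmx c 0 0)%:M (vec_of_pairs t - dsubmx c).
Proof.
rewrite -[X in _ - X](vsubmxK c); apply/matrixP => i j; rewrite [j]ord1 !mxE.
case: splitP => k ik.
  rewrite !mxE !ord1 eqxx mulr1n; congr (_ - _).
  by rewrite (_ : i = ord0) //; apply/val_inj; rewrite /= ik ord1.
rewrite !mxE; congr (_ - _).
by rewrite (_ : i = lift ord0 k) ?tnthS //; apply/val_inj.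
Qed.

Lemma posdefmx_det_gt0 (n : nat) (H : 'M[C]_n) : posdefmx H -> 0 < \det H.
Proof.
elim: n H => [|n IH] H pH; first by rewrite det_mx00.
by rewrite det_schur // mulr_gt0 ?pivot_gt0 // IH //; exact: schur_compl_posdef.
Qed.

Lemma Re_realM (r : R) (z : C) : complex.Re (r%:C * z) = r * complex.Re z.
Proof. by case: z => x y /=; rewrite mul0r subr0. Qed.

(** Integrating out the first coordinate gives 2 pi over the pivot and leaves the Gaussian of the
    Schur complement; the pivots multiply to the determinant. The centre [c] is carried along, so
    the measure is never translated. *)
Lemma integral_gaussCn (n : nat) (H : 'M[C]_n) (c : 'cV[C]_n) : posdefmx H ->
  (\int[lebesgue_Cn R n]_t
     (expR (- (2^-1 * quad_form H (vec_of_pairs t - c))))%:E =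
   ((2 * pi) ^+ n / complex.Re (\det H))%:E)%E.
Proof.
elim: n H c => [|n IH] H c pH.
  (* In dimension 0 the measure is a point mass and the determinant is 1. *)
  rewrite /lebesgue_Cn /= integral_dirac //; last exact: measurable_gauss.
  rewrite diracT mul1e /quad_form det_mx00 mxE big_ord0.
  by rewrite mulr0 oppr0 expR0 expr0 divr1.
rewrite /lebesgue_Cn /= /pow_measure_step ge0_integral_pushforward //;
  last exact: measurable_gauss.
have a0 := pivot_gt0 pH; have pH' := schur_compl_posdef pH.
set a := pivot H in a0 *; set H' := schur_compl H in pH' *.
have aE : a = (complex.Re a)%:C by rewrite RRe_real // gtr0_real.
have ra0 : 0 < complex.Re a by rewrite -ltcR -aE.
(* Centre of the Gaussian in the first coordinate once [t] fixes the others. *)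
pose m (t : n.-tuple (R * R)) : C := usubmx (c : 'cV[C]_(1 + n)) 0 0
  - a^-1 * ((map_mx Num.conj (dlsubmx (H : 'M[C]_(1 + n)))^T) *m
      (vec_of_pairs t - dsubmx (c : 'cV[C]_(1 + n)))) 0 0.
pose g (t : n.-tuple (R * R)) p := expR (- (2^-1 * (complex.Re a *
  complex.Re (Num.conj ((p.1 +i* p.2) - m t) * ((p.1 +i* p.2) - m t))))).
pose h (t : n.-tuple (R * R)) :=
  expR (- (2^-1 * quad_form H' (vec_of_pairs t - dsubmx (c : 'cV[C]_(1 + n))))).
have gauss_split p t : expR (- (2^-1 * quad_form H (vec_of_pairs (cons_pair (p, t)) - c)))
    = g t p * h t.
  rewrite /g /h -expRD -opprD -mulrDr; congr (expR (- (_ * _))).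
  rewrite vec_of_pairs_cons /quad_form (schur_form pH) -/a -/H' raddfD /=.
  congr (_ + _); rewrite {1}aE.
  have -> : (p.1 +i* p.2) - usubmx (c : 'cV[C]_(1 + n)) 0 0 + a^-1 *
    ((map_mx Num.conj (dlsubmx (H : 'M[C]_(1 + n)))^T) *m
      (vec_of_pairs t - dsubmx (c : 'cV[C]_(1 + n)))) 0 0 = (p.1 +i* p.2) - m t.
    by rewrite /m; ring.
  exact: Re_realM.
have mh : measurable_fun setT (fun t => (h t)%:E) by exact: measurable_gauss.
have inner t : (\int[sfprod mu mu]_p (g t p * h t)%:E =
    (2 * pi / complex.Re a)%:E * (h t)%:E)%E.
  under eq_integral do rewrite EFinM.
  rewrite ge0_integralZr //=.
  - by congr (_ * _)%E; exact: integral_gauss2.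
  - apply/measurable_EFinP; apply: measurableT_comp => //; apply: measurable_funN.
    apply: measurable_funM => //; apply: measurable_funM => //.
    have cp : cmeasurable (fun p : measurableTypeR R * measurableTypeR R =>
        (p.1 +i* p.2) - m t).
      apply: cmeasurableD; last exact: cmeasurable_cst.
      by split => /=; [exact: measurable_fst|exact: measurable_snd].
    by have [] := cmeasurableM (cmeasurable_conj cp) cp.
  - by move=> p _; rewrite lee_fin expR_ge0.
  - by rewrite lee_fin expR_ge0.
rewrite preimage_setT /sfprod fubini_tonelli2 //=; last first.
  exact: measurableT_comp (measurable_gauss H c) (measurable_cons_pair (n := n)).
transitivity (\int[lebesgue_Cn R n]_t ((2 * pi / complex.Re a)%:E * (h t)%:E))%E.
  apply: eq_integral => t _; rewrite /fubini_G -inner.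
  by apply: eq_integral => p _; exact: (congr1 EFin (gauss_split p t)).
rewrite ge0_integralZl //=; last 2 first.
- by move=> t _; rewrite lee_fin expR_ge0.
- by rewrite lee_fin divr_ge0 ?mulr_ge0 ?pi_ge0 // ltW.
rewrite IH // -EFinM det_schur // -/a -/H'.
have -> : complex.Re (a * \det H') = complex.Re a * complex.Re (\det H').
  by rewrite {1}aE Re_realM.
have rd0 : 0 < complex.Re (\det H').
  by rewrite -ltcR RRe_real ?posdefmx_det_gt0 // gtr0_real // posdefmx_det_gt0.
congr (_%:E); rewrite exprS; field.
by rewrite !gt_eqF.
Qed.

End GaussianIntegralCn.

(** * The Dirichlet problem *)

Section Equivalences.
Local Open Scope sesquilinear_scope.
Variables (R : realType) (d : nat) (A : 'M[R[i]]_(d + d)) (W : 'M[R[i]]_d).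
Local Notation C := R[i].
Hypothesis W_unit : W \in unitmx.

Lemma mxpowzN (n : nat) : mxpowz W (- n%:Z) = invmx W ^+ n.
Proof. by case: n => [|n] //=; rewrite !expr0. Qed.

(** The neighbours of z = x_{-n-1} are W^-1 z and W z, so the recurrence at k = n + 1 is Phi(W)
    applied to z. *)
Lemma dirichlet_recurrence (n : nat) (x : 'cV[C]_d) :
  A_RL A *m (mxpowz W (- n.+1%:Z - 1) *m x)
  + (A_LL A + A_RR A) *m (mxpowz W (- n.+1%:Z) *m x)
  + A_LR A *m (mxpowz W (- n.+1%:Z + 1) *m x) =
  (A_LL A + A_RR A + A_LR A *m W + A_RL A *m invmx W) *m (invmx W ^+ n.+1 *m x).
Proof.
have -> : - n.+1%:Z - 1 = - n.+2%:Z by lia.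
have -> : - n.+1%:Z + 1 = - n%:Z by lia.
rewrite !mxpowzN; set z := invmx W ^+ n.+1 *m x.
have -> : invmx W ^+ n.+2 *m x = invmx W *m z by rewrite [in LHS]exprS mulmxA.
have -> : invmx W ^+ n *m x = W *m z.
  by rewrite /z exprS -[_ * _]/(_ *m _) -mulmxA mulKVmx.
rewrite [RHS]mulmxDl (mulmxDl _ (A_LR A *m W)) -!mulmxA -addrA.
exact: addrC.
Qed.

Lemma dirichlet_matrix_root :
  (forall x : 'cV[C]_d, dirichlet_solution A x (fun k => mxpowz W k *m x)) ->
  matrix_root A W.
Proof.
move=> dir; apply/matrixP => i j.
(* Starting from [W *m delta_mx j 0] makes x_{-1} the j-th basis vector, so the recurrence at k = 1
   gives column j of Phi(W). *)
have [/(_ 1 isT) + _ _] := dir (W *m delta_mx j 0).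
rewrite (dirichlet_recurrence 0) expr1 mulKmx // -colE.
by move=> /matrixP/(_ i 0); rewrite [LHS]mxE => ->; rewrite !mxE.
Qed.

Lemma dirichlet_eigenvalue_gt1 (w : C) (v : 'cV[C]_d) :
  dirichlet_solution A v (fun k => mxpowz W k *m v) ->
  v != 0 -> W *m v = w *: v -> 1 < `|w|.
Proof.
move=> [_ _ /cvg0_col lim0] v0 Wv; have w0 := eigenvalue_neq0 W_unit v0 Wv.
have [i vi0] : exists i, v i 0 != 0.
  apply/existsP; apply: contraNT v0 => /existsPn vi; apply/eqP/matrixP => i j.
  by rewrite [j]ord1 mxE; apply/eqP; have := vi i; rewrite negbK.
(* With |v_i| as tolerance, some |w|^-N is below 1, which excludes |w| <= 1. *)
have /cvg0P/(_ `|v i 0|) := lim0 i; rewrite normr_gt0 => /(_ vi0) [N _ /(_ N (leqnn N))].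
rewrite /= mxpowzN (invmx_exp_eigenvector W_unit N w0 Wv) mxE normrM.
rewrite gtr_pMl ?normr_gt0 // normrX normfV => wN.
rewrite real_ltNge ?normr_real //; apply: contraTN wN => w1.
by rewrite -real_leNgt ?exprn_ege1 ?invf_ge1 ?normr_gt0 //= ?rpredX ?realV ?normr_real.
Qed.

Hypothesis A_herm : A \is hermsymmx.
Local Notation B := (A_RR A + A_RL A *m invmx W).

(** As a function of x the exponent is that of a Gaussian of matrix H = B + A_LL centred at W^-1 y;
    the remainder, the form of B at y, is what makes [e_vertex] an eigenfunction. *)
Lemma complete_square (x y : 'cV[C]_d) : matrix_root A W -> B \is hermsymmx ->
  quad_form B x + quad_form A (col_mx x y) =
  quad_form (B + A_LL A) (x - invmx W *m y) + quad_form B y.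
Proof.
move=> rW /hermsymmxP hB; pose H := B + A_LL A.
rewrite -/H /quad_form -!raddfD /=; congr (complex.Re _).
rewrite block_form -!mulmxA; set v := invmx W *m y.
(* By the root equation, [v] is the centre at which the terms linear in x are absorbed. *)
have Hv : H *m v = - (A_LR A *m y).
  by rewrite /H ((matrix_rootE A W).1 rW) mulNmx -mulmxA mulKVmx.
have vH : v^t* *m H = - (y^t* *m A_RL A).
  rewrite -[LHS]trmxCK adjmxM trmxCK.
  have -> : H^t* = H by rewrite /H adjmxD hB adj_A_LL.
  by rewrite Hv adjmxN adjmxM adj_A_LR.
have Bv (z : 'cV[C]_d) : B *m z = H *m z - A_LL A *m z by rewrite -mulmxBl addrK.
have By : B *m y = A_RR A *m y + A_RL A *m v by rewrite mulmxDl mulmxA.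
have -> : (x - v)^t* *m (H *m (x - v)) =
    x^t* *m (H *m x + A_LR A *m y) + y^t* *m (A_RL A *m (x - v)).
  rewrite adjmxD adjmxN mulmxDl mulNmx [v^t* *m _]mulmxA vH mulNmx opprK -mulmxA.
  by rewrite [H *m _]mulmxBr Hv opprK.
rewrite (Bv x) By !mulmxBr !mulmxDr.
move: (x^t* *m (H *m x)) (x^t* *m (A_LL A *m x)) (x^t* *m (A_LR A *m y))
  (y^t* *m (A_RL A *m x)) (y^t* *m (A_RR A *m y)) (y^t* *m (A_RL A *m v)).
by move=> a b c e f g; rewrite !mxE; ring.
Qed.

End Equivalences.

(** * Equivalence of the three assertions, and the eigenvalue *)

Theorem theorem1p3 (R : realType) (d : nat) (d_ge1 : (1 <= d)%N)
    (A : 'M[R[i]]_(d + d)) (A_pos : posdefmx A)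
    (A_I : assumptionI A) (A_II : assumptionII A)
    (u : R[i] -> 'cV[R[i]]_d) (u_ker : spans_kernels A u)
    (W : 'M[R[i]]_d) (W_unit : W \in unitmx) (W_diag : diagonalizable W) :
  let B_L := A_RR A + A_RL A *m invmx W in
  let assertion_i := left_schur_invariant A B_L in
  let assertion_ii := diagonal_in_basis (spec_gt1 A) u W in
  let assertion_iii := forall x : 'cV[R[i]]_d,
    dirichlet_solution A x (fun k : int => mxpowz W k *m x) in
  [/\ assertion_i <-> assertion_ii,
      assertion_ii <-> assertion_iii
    & assertion_i -> forall alpha beta_L : R, 0 < alpha -> 0 < beta_L ->
      exists Lambda : R,
        Lambda%:C = alpha%:C * (2 * pi)%:C ^+ d * (-1) ^+ d *
          ((\big[*%R/1]_(w \in spec_lt1 A) w) / \det (A_RL A)) /\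
        forall y : 'cV[R[i]]_d,
          (\int[lebesgue_Cn R d]_t
             (e_vertex beta_L B_L (vec_of_pairs t) *
              e_edge alpha A (vec_of_pairs t) y)%:E)%E
          = (Lambda * e_vertex beta_L B_L y)%:E].
Proof.
move=> B i ii iii; have A_herm : A \is hermsymmx by case: A_pos.
have A_LR_unit : A_LR A \in unitmx.
  by rewrite -row_free_unit /row_free; apply/eqP.
have diag := matrix_root_diagonal A_herm A_LR_unit u_ker W_unit W_diag.
(* Common route from (i) and (iii) to (ii): each yields a matrix root with all eigenvalues outside
   the closed unit disk. *)
have gt1_ii : matrix_root A W ->
    (forall (w : R[i]) (v : 'cV[R[i]]_d), v != 0 -> W *m v = w *: v -> 1 < `|w|) -> ii.
  move=> rW gt1; have [s [us sE bs Wu _]] := diag rW gt1; split; first by exists s.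
  by move=> w; rewrite sE; exact: Wu.
have i_ii : i -> ii.
  move=> hi; apply: gt1_ii; first exact: schur_matrix_root hi.
  by move=> w v; exact: schur_eigenvalue_gt1 hi.
have S_gt1 w : spec_gt1 A w -> 1 < `|w| by case.
(* Phi(W) kills every [u w], hence a basis. *)
have ii_root : ii -> matrix_root A W.
  move=> [bu Wu]; apply: (basis_family_eq0 bu) => w w1.
  have [sw _] := w1.
  rewrite -(Phi_eigenvector A W_unit (spec_neq0 sw) (Wu w w1)).
  by have [_ /(_ (u w)) [_]] := u_ker w sw; apply; exists 1; rewrite scale1r.
(* The Stein equation gives Hermitian symmetry, the decay of W^-n gives positivity. *)
have ii_i : ii -> i.
  move=> hii; have rW := ii_root hii; have [bu Wu] := hii.
  apply: matrix_root_schur => //; apply: posdefmx_of_decay => //.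
    by apply: matrix_root_herm => // N; exact: (stein_eq0 bu S_gt1 Wu).
  by move=> x j; exact: (invmx_powers_cvg0 bu S_gt1 Wu W_unit).
split.
- by split.
- split=> [hii x|hiii].
    have rW := ii_root hii; have [bu Wu] := hii; split.
    + case=> [[|n]|n] // _; rewrite dirichlet_recurrence //.
      by rewrite (_ : _ + A_RL A *m invmx W = 0) ?mul0mx.
    + by rewrite -[0]/(- (0%N)%:Z) mxpowzN expr0 mul1mx.
    + apply/cvg0_col => j; under eq_cvg do rewrite mxpowzN.
      exact: (invmx_powers_cvg0 bu S_gt1 Wu W_unit).
  apply: gt1_ii; first exact: dirichlet_matrix_root.
  by move=> w v; exact: dirichlet_eigenvalue_gt1.
move=> hi alpha beta alpha0 beta0.
have rW := schur_matrix_root A_pos A_LR_unit W_unit hi; have [pB _] := hi.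
have pH := posdefmxD pB (posdefmx_A_LL A_pos); set H := B + A_LL A in pH.
have detH_gt0 := posdefmx_det_gt0 pH.
(* The witness is alpha times the Gaussian integral for [H]; [complex.Re] loses nothing, since det H
   is real and positive. *)
exists (alpha * ((2 * pi) ^+ d / complex.Re (\det H))); split.
  have [s [us sE _ _ detW]] := diag rW
    (fun w v => schur_eigenvalue_gt1 A_pos A_LR_unit W_unit hi).
  (* Reflection carries the list [s] of S_{>1} onto S_{<1}, turning the product over a set into one
     over a list. *)
  have lt1E : spec_lt1 A = [set` map (@invconj R) s].
    apply/seteqP; split => w /= => [w1|/mapP[z zs ->]].
      rewrite -[w]invconjK map_f //.
      by have := invconj_lt1 A_herm w1; rewrite sE.
    by apply: invconj_gt1 => //; rewrite sE.
  rewrite lt1E -fsbig_seq ?map_inj_uniq ?big_map //; last exact: (inv_inj (@invconjK R)).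
  have detHE : \det H = (-1) ^+ d * (\det (A_LR A) * \det W).
    by rewrite /H ((matrix_rootE A W).1 rW) -scaleN1r detZ det_mulmx.
  have detQ : \det (A_RL A) = Num.conj (\det (A_LR A)).
    by rewrite -adj_A_LR // det_map_mx det_tr.
  have prodE : \prod_(w <- s) invconj w = (Num.conj (\det W))^-1.
    rewrite detW rmorph_prod prodfV.
    by [].
  (* Since det H is real it may be conjugated, which brings in det A_RL and the conjugate of det
     W. *)
  have detHr : \det H = (-1) ^+ d * (Num.conj (\det (A_LR A)) * Num.conj (\det W)).
    rewrite -[LHS]conj_Creal ?gtr0_real // detHE !rmorphM rmorphXn rmorphN1.
    by [].
  have eV : ((-1) ^+ d)^-1 = (-1) ^+ d :> R[i] by rewrite -exprVn invrN1.
  have -> : (alpha * ((2 * pi) ^+ d / complex.Re (\det H)))%:C =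
      alpha%:C * ((2 * pi)%:C ^+ d * (\det H)^-1).
    rewrite rmorphM rmorphM fmorphV rmorphXn; congr (_ * (_ * _^-1)).
    exact/RRe_real/gtr0_real.
  by rewrite prodE detQ detHr !invfM eV; ring.
move=> y; set v := invmx W *m y.
(* After completing the square, [y] enters only through a constant factor and the centre [v], on
   which the Gaussian integral does not depend. *)
transitivity (\int[lebesgue_Cn R d]_t ((alpha * e_vertex beta B y)%:E *
    (expR (- (2^-1 * quad_form H (vec_of_pairs t - v))))%:E))%E.
  apply: eq_integral => t _; rewrite -EFinM; congr (_%:E).
  rewrite /e_vertex /e_edge mulrACA -expRD -opprD -mulrDr.
  rewrite complete_square //; last by case: pB.
  rewrite mulrDr opprD expRD.
  rewrite -/v; ring.
rewrite ge0_integralZl //=; last 2 first.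
- exact: measurable_gauss.
- by rewrite lee_fin !mulr_ge0 ?expR_ge0 // ltW.
by rewrite integral_gaussCn // -EFinM; congr (_%:E); ring.
Qed.
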